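(* Let $k\in[2,3)$ be rational and $\varepsilon$ a positive real with $\varepsilon<\frac{1+\varepsilon}{k+\varepsilon}$. Then there exist a graph $G$ with fractional chromatic number $k$, a set $W\subseteq V(G)$ of vertices at pairwise distance at least four, and a fractional $(k+\varepsilon)$-precoloring of $W$ that cannot be extended to a fractional $(k+\varepsilon)$-coloring of $G$.
   Context: A fractional $m$-coloring of a graph (real $m>0$) assigns to each vertex a measurable subset of $[0,m)$ of Lebesgue measure one so that adjacent vertices receive disjoint sets; the fractional chromatic number is the infimum (for finite graphs the minimum) of $m$ for which a fractional $m$-coloring exists. A fractional $m$-precoloring of a vertex set $W$ assigns measurable subsets of $[0,m)$ of measure one to the vertices of $W$; it extends if some fractional $m$-coloring of the whole graph agrees with it on $W$. Graphs are finite. *)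

(* Defs.v *)
From Stdlib Require Import Reals Lra QArith Qreals.
Open Scope R_scope.

Definition interval_cover (a b : nat -> R) (A : R -> Prop) : Prop :=
  (forall n, a n <= b n) /\ (forall x, A x -> exists n, a n < x < b n).

Definition outer_measure (A : R -> Prop) (r : R) : Prop :=
  (forall a b l, interval_cover a b A ->
       infinite_sum (fun n => b n - a n) l -> r <= l) /\
  (forall eps, 0 < eps -> exists a b l, interval_cover a b A /\
       infinite_sum (fun n => b n - a n) l /\ l < r + eps).

Definition bounded_set (E : R -> Prop) : Prop :=
  exists M, forall x, E x -> Rabs x <= M.

(* Caratheodory measurability (test sets of finite outer measure; it suffices
   to test bounded sets). *)
Definition lebesgue_measurable (A : R -> Prop) : Prop :=
  forall E r, bounded_set E -> outer_measure E r ->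
    exists r1 r2, outer_measure (fun x => E x /\ A x) r1 /\
                  outer_measure (fun x => E x /\ ~ A x) r2 /\ r = r1 + r2.

Definition unit_subset (m : R) (S : R -> Prop) : Prop :=
  (forall x, S x -> 0 <= x < m) /\ lebesgue_measurable S /\ outer_measure S 1.

Record graph := Graph {
  gn : nat;
  gadj : nat -> nat -> Prop;
  gadj_sym : forall u v, gadj u v -> gadj v u;
  gadj_irrefl : forall v, ~ gadj v v;
  gadj_vert : forall u v, gadj u v -> (u < gn)%nat /\ (v < gn)%nat
}.

Definition vertex (G : graph) (v : nat) : Prop := (v < gn G)%nat.

Fixpoint walk (G : graph) (k : nat) (u v : nat) : Prop :=
  match k with
  | O => u = v
  | S k' => exists w, gadj G u w /\ walk G k' w v
  end.

Definition dist_le (G : graph) (u v : nat) (d : nat) : Prop :=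
  exists k, (k <= d)%nat /\ walk G k u v.

Definition pairwise_dist_ge4 (G : graph) (W : nat -> Prop) : Prop :=
  forall u v, W u -> W v -> u <> v -> ~ dist_le G u v 3.

Definition frac_coloring (G : graph) (m : R) (f : nat -> R -> Prop) : Prop :=
  0 < m /\
  (forall v, vertex G v -> unit_subset m (f v)) /\
  (forall u v, gadj G u v -> forall x, ~ (f u x /\ f v x)).

Definition frac_colorable (G : graph) (m : R) : Prop :=
  exists f, frac_coloring G m f.

Definition frac_chromatic_number (G : graph) (k : R) : Prop :=
  (forall m, frac_colorable G m -> k <= m) /\
  (forall k', (forall m, frac_colorable G m -> k' <= m) -> k' <= k).

Definition frac_precoloring (G : graph) (m : R) (W : nat -> Prop)
    (p : nat -> R -> Prop) : Prop :=
  0 < m /\ (forall w, W w -> unit_subset m (p w)).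

Definition precoloring_extends (G : graph) (m : R) (W : nat -> Prop)
    (p : nat -> R -> Prop) : Prop :=
  exists f, frac_coloring G m f /\ (forall w, W w -> forall x, f w x <-> p w x).

(* Main.v *)
Require Import Defs.
From Stdlib Require Import Reals QArith Qreals ZArith Lra Lia List Classical ClassicalEpsilon.
From Stdlib Require Import FunctionalExtensionality PropExtensionality.
Open Scope R_scope.

(** The graph is the circular clique K_{p/q} with [k = p/q], enlarged, for every clique
vertex [v] and every [i < n], by a vertex [u] adjacent to all neighbours of [v] in the
clique and by a pendant vertex attached to [u]. The pendant vertices are precolored by the
arcs of length one starting at the [n] multiples of [m/n] on the circle of length
[m = k + eps].

An independent set [I] of K_{p/q} satisfies [|N(I)| >= (k - 1) |I|]. Integrating this over
the colors, in every [m]-coloring some clique vertex [v] has neighbours whose colors fill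
a set [U] of measure at least [k - 1]. For a typical arc [C] the part of [C] inside [U] has
measure about [|U| / m], so [U] and [C] together cover about [|U| (1 - 1/m) + 1], which
exceeds [m - 1] exactly under the assumption on [eps]; no color set of measure one is then
left for [u]. *)

(** * Outer measure *)

Lemma set_ext {T : Type} (A B : T -> Prop) : (forall x, A x <-> B x) -> A = B.
Proof.
  intro H. apply functional_extensionality; intro x.
  now apply propositional_extensionality.
Qed.

Lemma infinite_sum_of_bounded (u : nat -> R) (L : R) :
  (forall n, 0 <= u n) -> (forall n, sum_f_R0 u n <= L) ->
  exists l, infinite_sum u l /\ l <= L.
Proof.
  intros u0 uL.
  assert (gr : Un_growing (sum_f_R0 u)) by (intro n; simpl; specialize (u0 (S n)); lra).
  assert (ub : has_ub (sum_f_R0 u)) by (exists L; intros x [n ->]; apply uL).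
  destruct (growing_cv _ gr ub) as [l Hl].
  exists l; split; [exact Hl|].
  apply Rnot_lt_le; intro Ll.
  destruct (Hl (l - L)) as [N HN]; [lra|].
  specialize (HN N (le_n N)). specialize (uL N).
  unfold Rdist in HN. apply Rabs_def2 in HN. lra.
Qed.

Lemma infinite_sum_partial_le (u : nat -> R) (l : R) (n : nat) :
  (forall n, 0 <= u n) -> infinite_sum u l -> sum_f_R0 u n <= l.
Proof. intros u0 Hl. exact (sum_incr u n l Hl u0). Qed.

(** Serves to merge two countable covers into one sequence, the first on the even indices and the
    second on the odd ones. *)
Lemma sum_f_R0_interleave (u v : nat -> R) (n : nat) :
  sum_f_R0 (fun i => if Nat.even i then u (Nat.div2 i) else v (Nat.div2 i)) (S (2 * n)) =
  sum_f_R0 u n + sum_f_R0 v n.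
Proof.
  induction n as [|n IH]; [simpl; lra|].
  replace (S (2 * S n)) with (S (S (S (2 * n)))) by lia.
  rewrite 2!tech5, IH.
  replace (S (S (2 * n))) with (2 * S n)%nat by lia.
  rewrite Nat.even_succ, <- Nat.negb_even, !Nat.even_mul, Nat.div2_succ_double, Nat.div2_double.
  simpl; lra.
Qed.

(** [outer_measure A r] says that [r] is the infimum of these [l]. *)
Definition covers (A : R -> Prop) (l : R) : Prop :=
  exists a b, interval_cover a b A /\ infinite_sum (fun n => b n - a n) l.

Lemma outer_measureE (A : R -> Prop) (r : R) :
  outer_measure A r <->
  (forall l, covers A l -> r <= l) /\
  (forall eps, 0 < eps -> exists l, covers A l /\ l < r + eps).
Proof.
  split; intros [low up]; split.
  - intros l (a & b & C & S). exact (low a b l C S).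
  - intros e He. destruct (up e He) as (a & b & l & C & S & Hl).
    exists l; split; [now exists a, b|exact Hl].
  - intros a b l C S. apply low. now exists a, b.
  - intros e He. destruct (up e He) as (l & (a & b & C & S) & Hl).
    now exists a, b, l.
Qed.

Lemma covers_nonneg (A : R -> Prop) (l : R) : covers A l -> 0 <= l.
Proof.
  intros (a & b & [ab _] & S).
  assert (p : forall n, 0 <= b n - a n) by (intro n; specialize (ab n); lra).
  generalize (infinite_sum_partial_le _ _ 0 p S) (p 0%nat); simpl; lra.
Qed.

Lemma covers_sub (A B : R -> Prop) (l : R) :
  (forall x, A x -> B x) -> covers B l -> covers A l.
Proof.
  intros AB (a & b & [ab C] & S). exists a, b; split; [split|]; auto.
Qed.

Lemma covers_open_interval (s t : R) :
  s <= t -> covers (fun x => s < x < t) (t - s).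
Proof.
  intro st.
  exists (fun n => match n with O => s | _ => 0 end),
         (fun n => match n with O => t | _ => 0 end).
  split; [split|].
  - intros [|n]; lra.
  - intros x Hx; now exists 0%nat.
  - intros e He; exists 0%nat; intros n _.
    replace (sum_f_R0 _ n) with (t - s).
    + unfold Rdist. rewrite Rminus_diag, Rabs_R0. exact He.
    + induction n as [|n IH]; simpl in *; lra.
Qed.

Lemma covers_union (A B : R -> Prop) (l l' : R) :
  covers A l -> covers B l' ->
  exists l'', covers (fun x => A x \/ B x) l'' /\ l'' <= l + l'.
Proof.
  intros (a & b & [ab C] & Hl) (a' & b' & [ab' C'] & Hl').
  set (c := fun i => if Nat.even i then b (Nat.div2 i) - a (Nat.div2 i)
                     else b' (Nat.div2 i) - a' (Nat.div2 i)).
  assert (p : forall n, 0 <= b n - a n) by (intro n; specialize (ab n); lra).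
  assert (p' : forall n, 0 <= b' n - a' n) by (intro n; specialize (ab' n); lra).
  assert (c0 : forall n, 0 <= c n) by (intro n; unfold c; destruct (Nat.even n); auto).
  destruct (infinite_sum_of_bounded c (l + l') c0) as (s & Hs & sl).
  (* Partial sums grow, so the one up to [n] is at most the one up to [2 * n + 1], which contains
     exactly the first [n + 1] terms of both families. *)
  { intro n. apply Rle_trans with (sum_f_R0 c (S (2 * n))).
    - assert (G : Un_growing (sum_f_R0 c)) by (intro i; simpl; specialize (c0 (S i)); lra).
      apply Rge_le, (growing_prop _ _ _ G). lia.
    - unfold c. rewrite (sum_f_R0_interleave (fun n => b n - a n) (fun n => b' n - a' n)).
      apply Rplus_le_compat; now apply infinite_sum_partial_le. }
  exists s; split; [|exact sl].
  exists (fun i => if Nat.even i then a (Nat.div2 i) else a' (Nat.div2 i)),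
         (fun i => if Nat.even i then b (Nat.div2 i) else b' (Nat.div2 i)).
  split; [split|].
  - intro n; destruct (Nat.even n); auto.
  - intros x [Ax|Bx].
    + destruct (C x Ax) as [n Hn]; exists (2 * n)%nat.
      now rewrite Nat.even_mul, Nat.div2_double.
    + destruct (C' x Bx) as [n Hn]; exists (S (2 * n)).
      now rewrite Nat.even_succ, <- Nat.negb_even, Nat.even_mul, Nat.div2_succ_double.
  - replace (fun n => _ - _) with c; [exact Hs|].
    apply functional_extensionality; intro n; unfold c; now destruct (Nat.even n).
Qed.

Lemma bounded_set_sub (A B : R -> Prop) :
  (forall x, A x -> B x) -> bounded_set B -> bounded_set A.
Proof. intros AB [M HM]; exists M; auto. Qed.

Lemma bounded_set_within (A : R -> Prop) (s t : R) :
  (forall x, A x -> s <= x <= t) -> bounded_set A.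
Proof.
  intro H; exists (Rabs s + Rabs t); intros x Ax; specialize (H x Ax).
  revert H; unfold Rabs; repeat destruct Rcase_abs; lra.
Qed.

(** Completeness provides suprema, so the infimum of the cover lengths is obtained by negation;
    boundedness supplies one cover to start with. *)
Lemma outer_measure_exists (A : R -> Prop) :
  bounded_set A -> exists r, outer_measure A r.
Proof.
  intros [M HM].
  set (E := fun y => covers A (- y)).
  assert (bE : bound E) by (exists 0; intros y Hy; generalize (covers_nonneg _ _ Hy); lra).
  assert (iE : exists y, E y).
  (* [M] may be negative when [A] is empty, hence [Rabs M]; adding one puts [A] inside an open
     interval. *)
  { set (t := Rabs M + 1). exists (- (t - - t)); unfold E; rewrite Ropp_involutive.
    apply covers_sub with (B := fun x => - t < x < t).
    - intros x Ax; specialize (HM x Ax).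
      generalize (Rle_abs M) (Rle_abs x) (Rle_abs (- x)); rewrite Rabs_Ropp; unfold t; lra.
    - apply covers_open_interval; generalize (Rabs_pos M); unfold t; lra. }
  destruct (completeness E bE iE) as [y [ub lub]].
  exists (- y); apply outer_measureE; split.
  - intros l Hl. generalize (ub (- l)); unfold E; rewrite Ropp_involutive.
    intro H; specialize (H Hl); lra.
  - intros e He. apply NNPP; intro N.
    apply (Rlt_irrefl y), Rle_lt_trans with (y - e); [|lra].
    apply lub; intros z Ez. apply Rnot_lt_le; intro Hz.
    apply N; exists (- z); split; [exact Ez|lra].
Qed.

Lemma outer_measure_mono (A B : R -> Prop) (r s : R) :
  (forall x, A x -> B x) -> outer_measure A r -> outer_measure B s -> r <= s.
Proof.
  intros AB HA HB. apply outer_measureE in HA, HB.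
  destruct HA as [low _], HB as [_ up].
  apply le_epsilon; intros e He.
  destruct (up e He) as (l & Cl & Hl).
  generalize (low l (covers_sub _ _ _ AB Cl)); lra.
Qed.

Lemma outer_measure_unique (A : R -> Prop) (r s : R) :
  outer_measure A r -> outer_measure A s -> r = s.
Proof.
  intros; apply Rle_antisym; eapply outer_measure_mono with (A := A) (B := A); auto.
Qed.

(* Meaningful on bounded sets only. *)
Definition mu (A : R -> Prop) : R := epsilon (inhabits 0) (outer_measure A).

Lemma mu_outer_measure (A : R -> Prop) : bounded_set A -> outer_measure A (mu A).
Proof. intro HA; unfold mu; apply epsilon_spec, outer_measure_exists, HA. Qed.

Lemma mu_eq (A : R -> Prop) (r : R) : outer_measure A r -> mu A = r.
Proof.
  intro H; apply outer_measure_unique with A; [|exact H].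
  unfold mu; apply epsilon_spec; now exists r.
Qed.

Lemma mu_mono (A B : R -> Prop) :
  bounded_set B -> (forall x, A x -> B x) -> mu A <= mu B.
Proof.
  intros bB AB. apply (outer_measure_mono A B); auto using mu_outer_measure.
  apply mu_outer_measure, bounded_set_sub with B; auto.
Qed.

Lemma mu_subadd (A B : R -> Prop) :
  bounded_set (fun x => A x \/ B x) -> mu (fun x => A x \/ B x) <= mu A + mu B.
Proof.
  intro H.
  assert (HA : outer_measure A (mu A))
    by (apply mu_outer_measure; eapply bounded_set_sub; [|exact H]; cbv beta; tauto).
  assert (HB : outer_measure B (mu B))
    by (apply mu_outer_measure; eapply bounded_set_sub; [|exact H]; cbv beta; tauto).
  apply mu_outer_measure in H.
  apply outer_measureE in H, HA, HB. destruct H as [low _], HA as [_ uA], HB as [_ uB].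
  apply le_epsilon; intros e He.
  destruct (uA (e / 2)) as (l & Cl & Hl); [lra|].
  destruct (uB (e / 2)) as (l' & Cl' & Hl'); [lra|].
  destruct (covers_union _ _ _ _ Cl Cl') as (s & Cs & Hs).
  generalize (low s Cs); lra.
Qed.

Lemma mu_empty (A : R -> Prop) : (forall x, ~ A x) -> mu A = 0.
Proof.
  intro N. apply mu_eq, outer_measureE; split.
  - intros l Hl; apply (covers_nonneg _ _ Hl).
  - intros e He; exists (0 - 0); split; [|lra].
    apply covers_sub with (2 := covers_open_interval 0 0 (Rle_refl 0)).
    intros x Ax; now destruct (N x).
Qed.

Lemma mu_singleton (s : R) : mu (fun x => x = s) = 0.
Proof.
  apply mu_eq, outer_measureE; split.
  - intros l Hl; apply (covers_nonneg _ _ Hl).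
  - intros e He; exists ((s + e / 4) - (s - e / 4)); split; [|lra].
    apply covers_sub with (fun x => s - e / 4 < x < s + e / 4); [intros; lra|].
    apply covers_open_interval; lra.
Qed.

(** * Caratheodory measurability and the length of intervals *)

Lemma lebesgue_measurableE (A : R -> Prop) :
  lebesgue_measurable A <->
  forall E, bounded_set E -> mu E = mu (fun x => E x /\ A x) + mu (fun x => E x /\ ~ A x).
Proof.
  split.
  - intros H E bE.
    destruct (H E (mu E) bE (mu_outer_measure E bE)) as (r1 & r2 & H1 & H2 & ->).
    now rewrite (mu_eq _ _ H1), (mu_eq _ _ H2).
  - intros H E r bE Er.
    exists (mu (fun x => E x /\ A x)), (mu (fun x => E x /\ ~ A x)).
    split; [|split].
    + apply mu_outer_measure, bounded_set_sub with E; cbv beta; tauto.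
    + apply mu_outer_measure, bounded_set_sub with E; cbv beta; tauto.
    + rewrite <- (mu_eq _ _ Er); auto.
Qed.

Lemma measurable_union (A B : R -> Prop) :
  lebesgue_measurable A -> lebesgue_measurable B ->
  lebesgue_measurable (fun x => A x \/ B x).
Proof.
  rewrite !lebesgue_measurableE; intros HA HB E bE.
  rewrite (HA E bE), (HB (fun x => E x /\ ~ A x)), (HA (fun x => E x /\ (A x \/ B x)));
    try (apply bounded_set_sub with E; cbv beta; tauto).
  rewrite (set_ext (fun x => (E x /\ (A x \/ B x)) /\ A x) (fun x => E x /\ A x)),
    (set_ext (fun x => (E x /\ (A x \/ B x)) /\ ~ A x) (fun x => (E x /\ ~ A x) /\ B x)),
    (set_ext (fun x => E x /\ ~ (A x \/ B x)) (fun x => (E x /\ ~ A x) /\ ~ B x));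
    try (intro; tauto).
  lra.
Qed.

Lemma measurable_compl (A : R -> Prop) :
  lebesgue_measurable A -> lebesgue_measurable (fun x => ~ A x).
Proof.
  rewrite !lebesgue_measurableE; intros HA E bE.
  rewrite (HA E bE), (set_ext (fun x => E x /\ ~ ~ A x) (fun x => E x /\ A x)); [lra|].
  intro x; split; [|tauto]. intros [Ex NNA]; split; [exact Ex|now apply NNPP].
Qed.

Lemma measurable_inter (A B : R -> Prop) :
  lebesgue_measurable A -> lebesgue_measurable B ->
  lebesgue_measurable (fun x => A x /\ B x).
Proof.
  intros HA HB.
  rewrite (set_ext (fun x => A x /\ B x) (fun x => ~ (~ A x \/ ~ B x))).
  - apply measurable_compl, measurable_union; now apply measurable_compl.
  - intro x; split; [tauto|]. intro H; split; apply NNPP; tauto.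
Qed.

Lemma measurable_empty : lebesgue_measurable (fun _ => False).
Proof.
  apply lebesgue_measurableE; intros E bE.
  rewrite (mu_empty (fun x => E x /\ False)) by tauto.
  rewrite (set_ext (fun x => E x /\ ~ False) E) by (intro; tauto). lra.
Qed.

(** Every interval of the cover is cut at [s] into two open, possibly empty pieces. The point [s]
    lies in neither; [measurable_lt] can afford this because a singleton is null. *)
Lemma covers_split (E : R -> Prop) (s l : R) :
  covers E l ->
  exists l1 l2, covers (fun x => E x /\ x < s) l1 /\
                covers (fun x => E x /\ s < x) l2 /\ l1 + l2 <= l.
Proof.
  intros (a & b & [ab C] & Hl).
  set (u := fun n => Rmin (b n) s - Rmin (a n) s).
  set (v := fun n => Rmax (b n) s - Rmax (a n) s).
  assert (uv : forall n, 0 <= u n /\ 0 <= v n /\ u n + v n = b n - a n).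
  { intro n; unfold u, v; specialize (ab n); unfold Rmin, Rmax.
    repeat destruct Rle_dec; lra. }
  assert (sS : forall n, sum_f_R0 u n + sum_f_R0 v n <= l).
  { intro n; rewrite <- plus_sum.
    rewrite (sum_eq _ (fun n => b n - a n)) by (intros; apply uv).
    apply infinite_sum_partial_le; [intro i; specialize (ab i); lra|exact Hl]. }
  assert (pos : forall w, (forall n, 0 <= w n) -> forall n, 0 <= sum_f_R0 w n)
    by (intros w Hw n; now apply cond_pos_sum).
  destruct (infinite_sum_of_bounded v l) as (l2 & H2 & _); [apply uv| |].
  { intro n; generalize (sS n) (pos u (fun n => proj1 (uv n)) n); lra. }
  destruct (infinite_sum_of_bounded u (l - l2)) as (l1 & H1 & H12); [apply uv| |].
  (* A partial sum of [u] above [l - l2] would bound all partial sums of [v] by a number below their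
     limit [l2]. *)
  { intro n; apply Rnot_lt_le; intro Hn.
    destruct (infinite_sum_of_bounded v (l - sum_f_R0 u n)) as (l2' & H2' & H).
    - apply uv.
    - intro i.
      assert (G : forall w : nat -> R, (forall n, 0 <= w n) -> Un_growing (sum_f_R0 w))
        by (intros w Hw j; simpl; specialize (Hw (S j)); lra).
      generalize (growing_prop _ (max n i) n (G u (fun n => proj1 (uv n))) ltac:(lia))
        (growing_prop _ (max n i) i (G v (fun n => proj1 (proj2 (uv n)))) ltac:(lia))
        (sS (max n i)); lra.
    - rewrite (uniqueness_sum _ _ _ H2' H2) in H; lra. }
  exists l1, l2; split; [|split].
  - exists (fun n => Rmin (a n) s), (fun n => Rmin (b n) s); split; [split|exact H1].
    + intro n; generalize (proj1 (uv n)); unfold u; lra.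
    + intros x [Ex xs]; destruct (C x Ex) as [n Hn]; exists n.
      unfold Rmin; repeat destruct Rle_dec; lra.
  - exists (fun n => Rmax (a n) s), (fun n => Rmax (b n) s); split; [split|exact H2].
    + intro n; generalize (proj1 (proj2 (uv n))); unfold v; lra.
    + intros x [Ex xs]; destruct (C x Ex) as [n Hn]; exists n.
      unfold Rmax; repeat destruct Rle_dec; lra.
  - lra.
Qed.

Lemma measurable_lt (s : R) : lebesgue_measurable (fun x => x < s).
Proof.
  apply lebesgue_measurableE; intros E bE. apply Rle_antisym.
  - eapply Rle_trans; [|apply mu_subadd].
    + apply Req_le; f_equal; apply set_ext; intro x; tauto.
    + apply bounded_set_sub with E; cbv beta; tauto.
  - assert (Hr : mu (fun x => E x /\ ~ x < s) <= mu (fun x => E x /\ s < x)).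
    { rewrite <- (Rplus_0_r (mu (fun x => E x /\ s < x))), <- (mu_singleton s).
      assert (b' : bounded_set (fun x => (E x /\ s < x) \/ x = s)).
      { destruct bE as [M HM]; exists (Rabs M + Rabs s); intros x [[Ex _]| ->].
        - generalize (HM x Ex) (Rle_abs M) (Rabs_pos s); lra.
        - generalize (Rabs_pos M); lra. }
      eapply Rle_trans; [|apply mu_subadd, b'].
      apply mu_mono; [exact b'|]. intros x [Ex xs]; destruct (Rtotal_order x s); tauto. }
    apply le_epsilon; intros e He.
    destruct (proj2 (proj1 (outer_measureE _ _) (mu_outer_measure E bE)) e He) as (l & Cl & Hl).
    destruct (covers_split E s l Cl) as (l1 & l2 & C1 & C2 & H12).
    assert (B : forall P, bounded_set (fun x => E x /\ P x))
      by (intro P; apply bounded_set_sub with E; cbv beta; tauto).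
    generalize (proj1 (proj1 (outer_measureE _ _) (mu_outer_measure _ (B (fun x => x < s)))) l1 C1)
      (proj1 (proj1 (outer_measureE _ _) (mu_outer_measure _ (B (fun x => s < x)))) l2 C2); lra.
Qed.

(** Continuous induction replaces the choice of a finite subcover: the supremum of the points
    reached by finitely many intervals lies inside an open interval of the cover, which carries the
    estimate further. *)
Lemma covers_interval_length (s t l : R) :
  covers (fun x => s <= x < t) l -> t - s <= l.
Proof.
  intros (a & b & [ab C] & Hl).
  (* Stopping at [t - e] keeps the supremum [c] below strictly [t], so that the cover contains
     it. *)
  apply le_epsilon; intros e He. set (t' := t - e).
  destruct (Rlt_le_dec t' s) as [h|st].
  { assert (c : covers (fun x => s <= x < t) l) by (exists a, b; split; [split|]; assumption).
    generalize (covers_nonneg _ _ c); unfold t' in h; lra. }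
  set (g := fun x n => sum_f_R0 (fun i => Rmin (b i) x - Rmin (a i) x) n).
  assert (pos : forall x i, 0 <= Rmin (b i) x - Rmin (a i) x).
  { intros x i; specialize (ab i); unfold Rmin; repeat destruct Rle_dec; lra. }
  (* [g x n] is the length of the first [n + 1] intervals left of [x]: it grows at
     least as fast as [x] inside each of these intervals. *)
  set (P := fun x => s <= x <= t' /\ exists n, x - s <= g x n).
  assert (step : forall x y n, P x -> x <= y <= t' -> a n < x -> y < b n -> P y).
  { intros x y n [xs [k Hk]] xy an bn; split; [lra|]; exists (k + n)%nat.
    assert (Hm : g x k <= g x (k + n)%nat).
    { apply Rge_le, (growing_prop (fun n => g x n)); [|lia].
      intro i; unfold g; simpl; specialize (pos x (S i)); lra. }
    assert (Hd : y - x <= g y (k + n)%nat - g x (k + n)%nat); [|lra].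
    unfold g; rewrite <- minus_sum.
    set (d := fun i => Rmin (b i) y - Rmin (a i) y - (Rmin (b i) x - Rmin (a i) x)).
    change (y - x <= sum_f_R0 d (k + n)).
    assert (d0 : forall i, 0 <= d i).
    { intro i; specialize (ab i); unfold d, Rmin; repeat destruct Rle_dec; lra. }
    apply Rle_trans with (d n).
    - unfold d, Rmin; repeat destruct Rle_dec; lra.
    - apply Rle_trans with (sum_f_R0 d n).
      + destruct n; simpl; [lra|]. generalize (cond_pos_sum d n d0); lra.
      + apply Rge_le, growing_prop; [|lia]. intro i; simpl; specialize (d0 (S i)); lra. }
  assert (Ps : P s).
  { split; [lra|]; exists 0%nat; unfold g; simpl; specialize (pos s 0%nat); lra. }
  destruct (completeness P) as [c [ub lub]].
  { exists t'; intros x [xs _]; lra. }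
  { now exists s. }
  assert (sc : s <= c) by now apply ub.
  assert (ct : c <= t') by (apply lub; intros x [xs _]; lra).
  destruct (C c) as [n Hn]; [unfold t' in ct; lra|].
  assert (exists x, P x /\ a n < x <= c) as (x & Px & ax).
  { apply NNPP; intro N. assert (c <= a n); [|lra].
    apply lub; intros z Pz; apply Rnot_lt_le; intro h; apply N.
    exists z; split; [exact Pz|]. split; [exact h|now apply ub]. }
  (* [y] lies beyond [c] in the interval around [c], unless [t'] comes first. Since [P] holds at [y]
     and [c] bounds [P], only [y = t'] remains. *)
  set (y := Rmin t' ((c + b n) / 2)).
  assert (Hy : c <= y <= t' /\ y < b n /\ (y = t' \/ c < y)).
  { unfold y, Rmin; destruct Rle_dec; lra. }
  assert (Py : P y) by (apply (step x y n); [exact Px|lra..]).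
  assert (yt : y = t') by (generalize (ub y Py); lra).
  rewrite yt in Py; destruct Py as [_ [k Hk]].
  assert (g t' k <= l); [|unfold t' in *; lra].
  apply Rle_trans with (sum_f_R0 (fun i => b i - a i) k).
  - apply sum_Rle; intros i _; specialize (ab i); unfold Rmin; repeat destruct Rle_dec; lra.
  - apply infinite_sum_partial_le; [|exact Hl]. intro i; specialize (ab i); lra.
Qed.

Lemma mu_interval (s t : R) : s <= t -> mu (fun x => s <= x < t) = t - s.
Proof.
  intro st; apply mu_eq, outer_measureE; split.
  - intros l; apply covers_interval_length.
  - intros e He; exists (t - (s - e / 2)); split; [|lra].
    apply covers_sub with (fun x => s - e / 2 < x < t); [intros; lra|].
    apply covers_open_interval; lra.
Qed.

Lemma measurable_interval (s t : R) : lebesgue_measurable (fun x => s <= x < t).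
Proof.
  rewrite (set_ext (fun x => s <= x < t) (fun x => ~ x < s /\ x < t)) by (intro; lra).
  apply measurable_inter; [apply measurable_compl|]; apply measurable_lt.
Qed.

(** * Integration of simple functions *)

Definition indic (P : Prop) : R := if excluded_middle_informative P then 1 else 0.

Lemma indic_true (P : Prop) : P -> indic P = 1.
Proof. intro; unfold indic; now destruct excluded_middle_informative. Qed.

Lemma indic_false (P : Prop) : ~ P -> indic P = 0.
Proof. intro; unfold indic; now destruct excluded_middle_informative. Qed.

Ltac case_indic P :=
  let h := fresh "h" in
  destruct (classic P) as [h|h];
  [rewrite ?(indic_true P h) in *|rewrite ?(indic_false P h) in *].

Lemma indic_mono (P Q : Prop) : (P -> Q) -> indic P <= indic Q.
Proof. intro H; case_indic P; case_indic Q; try lra; tauto. Qed.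

Lemma indic_iff (P Q : Prop) : (P <-> Q) -> indic P = indic Q.
Proof. intro H; case_indic P; case_indic Q; try lra; tauto. Qed.

Fixpoint lsum {T : Type} (l : list T) (F : T -> R) : R :=
  match l with nil => 0 | i :: l' => F i + lsum l' F end.

Lemma lsum_le {T : Type} (l : list T) (F G : T -> R) :
  (forall i, In i l -> F i <= G i) -> lsum l F <= lsum l G.
Proof.
  induction l as [|i l IH]; simpl; intro H; [lra|].
  apply Rplus_le_compat; auto.
Qed.

Lemma lsum_ext {T : Type} (l : list T) (F G : T -> R) :
  (forall i, In i l -> F i = G i) -> lsum l F = lsum l G.
Proof.
  intro H; apply Rle_antisym; apply lsum_le; intros i Hi; rewrite H; auto; lra.
Qed.

Lemma lsum_app {T : Type} (l l' : list T) (F : T -> R) :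
  lsum (l ++ l') F = lsum l F + lsum l' F.
Proof. induction l as [|i l IH]; simpl; [|rewrite IH]; lra. Qed.

Lemma lsum_map {S T : Type} (h : S -> T) (l : list S) (F : T -> R) :
  lsum (map h l) F = lsum l (fun i => F (h i)).
Proof. induction l as [|i l IH]; simpl; [|rewrite IH]; lra. Qed.

Lemma lsum_add {T : Type} (l : list T) (F G : T -> R) :
  lsum l (fun i => F i + G i) = lsum l F + lsum l G.
Proof. induction l as [|i l IH]; simpl; [|rewrite IH]; lra. Qed.

Lemma lsum_scal {T : Type} (l : list T) (c : R) (F : T -> R) :
  lsum l (fun i => c * F i) = c * lsum l F.
Proof. induction l as [|i l IH]; simpl; [|rewrite IH]; lra. Qed.

Lemma lsum_const {T : Type} (l : list T) (c : R) :
  lsum l (fun _ => c) = INR (length l) * c.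
Proof.
  induction l as [|i l IH]; [simpl; lra|].
  simpl lsum; simpl length; rewrite IH, S_INR; lra.
Qed.

Lemma mu_split (E A : R -> Prop) :
  bounded_set E -> lebesgue_measurable A ->
  mu E = mu (fun x => E x /\ A x) + mu (fun x => E x /\ ~ A x).
Proof. intros bE HA; now apply (proj1 (lebesgue_measurableE A)). Qed.

(* Integration of a pointwise inequality between simple functions. Only the sets
   [A i] are split upon, so [X] need not be measurable. *)
Lemma lsum_mu_le {T : Type} (l : list T) (c : T -> R) (A : T -> R -> Prop)
    (X : R -> Prop) (d : R) :
  bounded_set X -> (forall i, In i l -> lebesgue_measurable (A i)) ->
  (forall x, X x -> lsum l (fun i => c i * indic (A i x)) <= d) ->
  lsum l (fun i => c i * mu (fun x => X x /\ A i x)) <= d * mu X.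
Proof.
  revert X d; induction l as [|j l IH]; simpl; intros X d bX mA H.
  (* For the empty list the hypothesis yields [0 <= d] only if [X] has a point; otherwise
     [mu X = 0]. *)
  - destruct (classic (exists x, X x)) as [[x Xx]|N].
    + apply Rmult_le_pos; [now apply (H x)|].
      rewrite <- (mu_empty (fun _ => False)) by tauto. now apply mu_mono.
    + rewrite mu_empty; [lra|]. intros x Xx; apply N; now exists x.
  - assert (mj : lebesgue_measurable (A j)) by auto.
    assert (b1 : bounded_set (fun x => X x /\ A j x))
      by (apply bounded_set_sub with X; cbv beta; tauto).
    assert (b2 : bounded_set (fun x => X x /\ ~ A j x))
      by (apply bounded_set_sub with X; cbv beta; tauto).
    (* Inside [A j] the term of [j] is the constant [c j] and moves to the right-hand side; outside
       [A j] it vanishes. *)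
    assert (H1 := IH (fun x => X x /\ A j x) (d - c j) b1 (fun i h => mA i (or_intror h))).
    assert (H2 := IH (fun x => X x /\ ~ A j x) d b2 (fun i h => mA i (or_intror h))).
    assert (Hs : forall i, c i * mu (fun x => X x /\ A i x) =
        c i * mu (fun x => (X x /\ A j x) /\ A i x) +
        c i * mu (fun x => (X x /\ ~ A j x) /\ A i x)).
    { intro i. rewrite (mu_split (fun x => X x /\ A i x) (A j));
        [|now apply bounded_set_sub with X; cbv beta; tauto|exact mj].
      rewrite (set_ext (fun x => (X x /\ A i x) /\ A j x) (fun x => (X x /\ A j x) /\ A i x)),
        (set_ext (fun x => (X x /\ A i x) /\ ~ A j x) (fun x => (X x /\ ~ A j x) /\ A i x))
        by (intro; tauto); lra. }
    rewrite (lsum_ext l _ _ (fun i _ => Hs i)), lsum_add, (mu_split X (A j) bX mj).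
    assert (H1' := H1 ltac:(
      intros x [Xx Ax]; specialize (H x Xx); rewrite (indic_true _ Ax) in H; lra)).
    assert (H2' := H2 ltac:(
      intros x [Xx Ax]; specialize (H x Xx); rewrite (indic_false _ Ax) in H; lra)).
    lra.
Qed.

(** * Arcs of length one on a circle of length [m] *)

Definition circle_arc (m s : R) (x : R) : Prop :=
  (s <= x < s + 1 /\ x < m) \/ 0 <= x < s + 1 - m.

(** The second interval of [circle_arc] is the part that wraps past [m]. As [1 <= m], it stays to
    the left of [s], so cutting at [s] separates the two pieces. *)
Lemma circle_arc_unit (m s : R) : 1 <= m -> 0 <= s < m -> unit_subset m (circle_arc m s).
Proof.
  intros m1 sm.
  assert (mA : lebesgue_measurable (circle_arc m s)).
  { rewrite (set_ext (circle_arc m s) (fun x => s <= x < Rmin m (s + 1) \/ 0 <= x < s + 1 - m)).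
    - apply measurable_union; apply measurable_interval.
    - intro x; unfold circle_arc, Rmin; destruct Rle_dec; lra. }
  assert (inc : forall x, circle_arc m s x -> 0 <= x < m) by (intro x; unfold circle_arc; lra).
  assert (bA : bounded_set (circle_arc m s)).
  { apply (bounded_set_within _ 0 m); intros x Hx; specialize (inc x Hx); lra. }
  split; [exact inc|split; [exact mA|]].
  replace 1 with (mu (circle_arc m s)); [now apply mu_outer_measure|].
  rewrite (mu_split _ _ bA (measurable_lt s)).
  rewrite (set_ext (fun x => circle_arc m s x /\ ~ x < s) (fun x => s <= x < Rmin m (s + 1)))
    by (intro x; unfold circle_arc, Rmin; destruct Rle_dec; lra).
  rewrite mu_interval by (unfold Rmin; destruct Rle_dec; lra).
  destruct (Rle_lt_dec (s + 1) m) as [h|h].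
  - rewrite mu_empty by (intro x; unfold circle_arc; lra).
    rewrite Rmin_right; lra.
  - rewrite (set_ext (fun x => circle_arc m s x /\ x < s) (fun x => 0 <= x < s + 1 - m))
      by (intro x; unfold circle_arc; lra).
    rewrite mu_interval, Rmin_left; lra.
Qed.

Lemma lsum_seq_S (F : nat -> R) (n : nat) :
  lsum (seq 0 (S n)) F = lsum (seq 0 n) F + F n.
Proof. rewrite seq_S, lsum_app; simpl; lra. Qed.

Lemma count_multiples (h u v : R) (n : nat) :
  0 < h -> u <= v ->
  h * lsum (seq 0 n) (fun i => indic (u <= INR i * h <= v)) <= v - u + h.
Proof.
  intros h0 uv.
  (* This bound ignores [v]. It is applied just before the last counted multiple, which is at most
     [v] and contributes the extra [h]. *)
  assert (A : forall n, h * lsum (seq 0 n) (fun i => indic (u <= INR i * h <= v)) <=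
                Rmax 0 (INR n * h - u)).
  { clear n; induction n as [|n IH]; [simpl; generalize (Rmax_l 0 (0 * h - u)); lra|].
    rewrite lsum_seq_S, S_INR; case_indic (u <= INR n * h <= v).
    - rewrite Rmax_right in IH |- *; lra.
    - apply Rle_trans with (Rmax 0 (INR n * h - u)); [lra|].
      apply Rle_max_compat_l; lra. }
  induction n as [|n IH]; [simpl; lra|].
  rewrite lsum_seq_S; case_indic (u <= INR n * h <= v); [|lra].
  specialize (A n); rewrite Rmax_right in A; lra.
Qed.

(** The arcs through [x] are those whose starting point lies in the arc of length one ending at [x].
    That arc consists of at most two intervals, one if [1 <= x], and each may contain one starting
    point more than its length accounts for. *)
Lemma circle_arc_overlap (m : R) (n : nat) (x : R) :
  0 < m -> (0 < n)%nat -> 0 <= x < m ->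
  lsum (seq 0 n) (fun i => indic (circle_arc m (INR i * (m / INR n)) x)) <= INR n / m + 2.
Proof.
  intros m0 n0 Hx. set (h := m / INR n).
  assert (N0 : 0 < INR n) by now apply lt_0_INR.
  assert (h0 : 0 < h) by now apply Rdiv_lt_0_compat.
  assert (hn : INR n * h = m) by (unfold h; field; lra).
  replace (INR n / m) with (/ h) by (unfold h; field; lra).
  apply Rmult_le_reg_l with h; [exact h0|].
  replace (h * (/ h + 2)) with (1 + 2 * h) by (field; lra).
  assert (below : forall i, In i (seq 0 n) -> 0 <= INR i * h < m).
  { intros i Hi; apply in_seq in Hi. split; [apply Rmult_le_pos; [apply pos_INR|lra]|].
    rewrite <- hn; apply Rmult_lt_compat_r; [exact h0|apply lt_INR; lia]. }
  destruct (Rle_lt_dec 1 x) as [x1|x1].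
  - apply Rle_trans with (h * lsum (seq 0 n) (fun i => indic (x - 1 <= INR i * h <= x))).
    + apply Rmult_le_compat_l; [lra|]. apply lsum_le; intros i Hi; apply indic_mono.
      specialize (below i Hi); unfold circle_arc; lra.
    + generalize (count_multiples h (x - 1) x n); lra.
  - apply Rle_trans with
      (h * lsum (seq 0 n) (fun i => indic (0 <= INR i * h <= x) +
                                    indic (x + m - 1 <= INR i * h <= m))).
    + apply Rmult_le_compat_l; [lra|]. apply lsum_le; intros i Hi.
      specialize (below i Hi).
      case_indic (circle_arc m (INR i * h) x); case_indic (0 <= INR i * h <= x);
        case_indic (x + m - 1 <= INR i * h <= m); unfold circle_arc in *; lra.
    + rewrite lsum_add.
      generalize (count_multiples h 0 x n) (count_multiples h (x + m - 1) m n); lra.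
Qed.

(** * Circular cliques *)

Definition circ_count (p : nat) (P : nat -> Prop) : R :=
  lsum (seq 0 p) (fun x => indic (P x)).

(** Vertex sets of K_{p/q} are treated as [p]-periodic sets of natural numbers, so that translations
    need no reduction modulo [p]. *)
Definition periodic (p : nat) (P : nat -> Prop) : Prop :=
  forall x, P (x + p)%nat <-> P x.

Lemma circ_count_nonneg (p : nat) (P : nat -> Prop) : 0 <= circ_count p P.
Proof.
  unfold circ_count; rewrite <- (Rmult_0_r (INR (length (seq 0 p)))), <- lsum_const.
  apply lsum_le; intros x _. rewrite <- (indic_false False) by tauto; now apply indic_mono.
Qed.

Lemma circ_count_le (p : nat) (P : nat -> Prop) : circ_count p P <= INR p.
Proof.
  unfold circ_count; rewrite <- (Rmult_1_r (INR p)).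
  rewrite <- (length_seq p 0) at 2; rewrite <- lsum_const.
  apply lsum_le; intros x _. rewrite <- (indic_true True I); now apply indic_mono.
Qed.

Lemma circ_count_shift (p c : nat) (P : nat -> Prop) :
  periodic p P -> circ_count p (fun x => P (x + c)%nat) = circ_count p P.
Proof.
  intro per; induction c as [|c IH].
  - apply lsum_ext; intros x _; now rewrite Nat.add_0_r.
  - rewrite <- IH; clear IH; set (Q := fun x => P (x + c)%nat).
    (* Telescoping; for [n = p] the two boundary terms cancel by periodicity. *)
    assert (T : forall n, lsum (seq 0 n) (fun x => indic (Q (S x))) =
                lsum (seq 0 n) (fun x => indic (Q x)) + indic (Q n) - indic (Q 0%nat)).
    { induction n as [|n IH]; [simpl; lra|]. rewrite !lsum_seq_S, IH; lra. }
    unfold circ_count. rewrite (lsum_ext _ _ (fun x => indic (Q (S x)))), T.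
    + replace (indic (Q p)) with (indic (Q 0%nat)); [lra|].
      apply indic_iff; unfold Q. rewrite (Nat.add_comm p c); simpl; symmetry; apply per.
    + intros x _; apply indic_iff; unfold Q. now replace (x + S c)%nat with (S x + c)%nat by lia.
Qed.

Lemma periodic_mul (p k x : nat) (P : nat -> Prop) :
  periodic p P -> P (x + k * p)%nat <-> P x.
Proof.
  intro per; induction k as [|k IH]; [now rewrite Nat.add_0_r|].
  replace (x + S k * p)%nat with (x + k * p + p)%nat by lia.
  now rewrite (per _).
Qed.

(** Either some point outside [P] has its successor in [P], and its residue is gained, or [P] is
    closed under predecessors and by periodicity contains everything. *)
Lemma circ_count_step (p : nat) (P : nat -> Prop) :
  (0 < p)%nat -> periodic p P -> (exists x, P x) ->
  (forall x, P x) \/ circ_count p P + 1 <= circ_count p (fun x => P x \/ P (S x)).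
Proof.
  intros p0 per [y Py].
  destruct (classic (exists x, ~ P x /\ P (S x))) as [(x & Nx & Px)|N].
  - right. set (z := (x mod p)%nat).
    assert (zp : (z < p)%nat) by (apply Nat.mod_upper_bound; lia).
    assert (zx : x = (z + (x / p) * p)%nat)
      by (unfold z; rewrite Nat.mul_comm, Nat.add_comm; apply Nat.div_mod_eq).
    assert (Nz : ~ P z) by (rewrite zx, periodic_mul in Nx; assumption).
    assert (Pz : P (S z)).
    { rewrite zx in Px; change (S (z + x / p * p)) with (S z + x / p * p)%nat in Px.
      now rewrite periodic_mul in Px. }
    unfold circ_count; replace p with (z + S (p - S z))%nat by lia.
    rewrite seq_app, !lsum_app; simpl.
    rewrite (indic_false _ Nz), (indic_true (P z \/ P (S z))) by tauto.
    assert (M : forall l, lsum l (fun x => indic (P x)) <=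
                          lsum l (fun x => indic (P x \/ P (S x)))).
    { intro l; apply lsum_le; intros; apply indic_mono; tauto. }
    generalize (M (seq 0 z)) (M (seq (S z) (p - S z))); lra.
  - left; intro x.
    assert (down : forall d u, P (u + d)%nat -> P u).
    { induction d as [|d IH]; intros u Hu; [now rewrite Nat.add_0_r in Hu|].
      apply IH, NNPP; intro Nu; apply N; exists (u + d)%nat.
      now rewrite Nat.add_succ_r in Hu. }
    (* As [p] is positive, [y + x * p] is a point of [P] not below [x]. *)
    apply (down (y + x * p - x)%nat).
    replace (x + (y + x * p - x))%nat with (y + x * p)%nat by nia.
    now apply periodic_mul.
Qed.

(* Adjacency in the circular clique K_{p/q}, lifted to the periodic integers. *)
Definition circ_nbr (p q : nat) (P : nat -> Prop) (x : nat) : Prop :=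
  exists d, (q <= d <= p - q)%nat /\ P (x + d)%nat.

(** Let I be the set and N its neighbourhood. N is a union of p - 2q + 1 consecutive translates of I
    and not everything, so |N| >= |I| + p - 2q. Since N and I are disjoint, |I| <= q, and both
    bounds follow. *)
Lemma circ_independent_bounds (p q : nat) (P : nat -> Prop) :
  (0 < q)%nat -> (2 * q <= p)%nat -> periodic p P ->
  (forall x, P x -> ~ circ_nbr p q P x) ->
  circ_count p P <= INR q /\
  (INR p - INR q) * circ_count p P <= INR q * circ_count p (circ_nbr p q P).
Proof.
  intros q0 pq per indep.
  assert (Q0 : 0 < INR q) by now apply lt_0_INR.
  assert (PQ : 2 * INR q <= INR p) by (apply le_INR in pq; rewrite mult_INR in pq; exact pq).
  destruct (classic (exists x, P x)) as [[y Py]|N].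
  2:{ assert (Z : circ_count p P = 0).
      { unfold circ_count; rewrite (lsum_ext _ _ (fun _ => 0)).
        - rewrite lsum_const; lra.
        - intros x _; apply indic_false; intro; apply N; now exists x. }
      rewrite Z; generalize (circ_count_nonneg p (circ_nbr p q P)); nra. }
  (* The union of the first [j + 1] translates; each further one adds a point by
     [circ_count_step]. *)
  set (Q := fun j x => exists d, (d <= j)%nat /\ P (x + d)%nat).
  assert (perQ : forall j, periodic p (Q j)).
  { intros j x; split; intros (d & dj & Hd); exists d; split; auto.
    - apply per. now replace (x + d + p)%nat with (x + p + d)%nat by lia.
    - replace (x + p + d)%nat with (x + d + p)%nat by lia. now apply per. }
  assert (grow : forall j, (forall x, Q j x) \/ circ_count p P + INR j <= circ_count p (Q j)).
  { induction j as [|j IH].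
    - right; simpl INR; rewrite Rplus_0_r; apply lsum_le; intros x _; apply indic_mono.
      intro Px; exists 0%nat; now rewrite Nat.add_0_r.
    - assert (E : Q (S j) = fun x => Q j x \/ Q j (S x)).
      { apply set_ext; intro x; split.
        - intros ([|d] & dj & Hd).
          + left; exists 0%nat; split; [lia|exact Hd].
          + right; exists d; split; [lia|]. now replace (S x + d)%nat with (x + S d)%nat by lia.
        - intros [(d & dj & Hd)|(d & dj & Hd)].
          + exists d; split; [lia|exact Hd].
          + exists (S d); split; [lia|]. now replace (x + S d)%nat with (S x + d)%nat by lia. }
      destruct IH as [IH|IH]; [left; intro x; rewrite E; now left|].
      destruct (circ_count_step p (Q j)) as [H|H]; [lia|apply perQ| | |].
      + exists y, 0%nat; split; [lia|now rewrite Nat.add_0_r].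
      + left; intro x; rewrite E; now left.
      + right; rewrite E, S_INR; lra. }
  assert (nbrE : circ_nbr p q P = fun x => Q (p - 2 * q)%nat (x + q)%nat).
  { apply set_ext; intro x; split; intros (d & dj & Hd).
    - exists (d - q)%nat; split; [lia|].
      now replace (x + q + (d - q))%nat with (x + d)%nat by lia.
    - exists (q + d)%nat; split; [lia|].
      now replace (x + (q + d))%nat with (x + q + d)%nat by lia. }
  assert (big : circ_count p P + (INR p - 2 * INR q) <= circ_count p (circ_nbr p q P)).
  { rewrite nbrE, circ_count_shift by apply perQ.
    replace (INR p - 2 * INR q) with (INR (p - 2 * q)).
    - destruct (grow (p - 2 * q)%nat) as [H|H]; [|exact H].
      exfalso; apply (indep y Py); rewrite nbrE; apply H.
    - rewrite minus_INR, mult_INR by exact pq; reflexivity. }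
  assert (disj : circ_count p P + circ_count p (circ_nbr p q P) <= INR p).
  { eapply Rle_trans; [|apply (circ_count_le p (fun x => P x \/ circ_nbr p q P x))].
    unfold circ_count; rewrite <- lsum_add; apply lsum_le; intros x _.
    specialize (indep x).
    case_indic (P x); case_indic (circ_nbr p q P x); try tauto;
      [rewrite indic_true by tauto|rewrite indic_true by tauto|rewrite indic_false by tauto]; lra. }
  split; [lra|nra].
Qed.

(** * Integration over the colors *)

Lemma lsum_pigeonhole {T : Type} (l : list T) (F : T -> R) (c : R) :
  l <> nil -> INR (length l) * c <= lsum l F -> exists i, In i l /\ c <= F i.
Proof.
  intros l0 H; apply NNPP; intro N.
  assert (lt : forall i, In i l -> F i < c)
    by (intros i Hi; apply Rnot_le_lt; intro; apply N; now exists i).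
  revert H; apply Rlt_not_le; rewrite <- lsum_const; clear N.
  induction l as [|i l IH]; [easy|]. simpl.
  specialize (lt i (or_introl eq_refl)) as lti.
  destruct l as [|j l]; [simpl; lra|].
  assert (lsum (j :: l) F < lsum (j :: l) (fun _ => c)); [|lra].
  apply IH; [easy|]. intros k Hk; apply lt; now right.
Qed.

Lemma measurable_finite_union {T : Type} (l : list T) (A : T -> R -> Prop) :
  (forall i, In i l -> lebesgue_measurable (A i)) ->
  lebesgue_measurable (fun x => exists i, In i l /\ A i x).
Proof.
  induction l as [|j l IH]; intro H.
  - rewrite (set_ext (fun x => exists i, In i nil /\ A i x) (fun _ => False))
      by (intro; split; [intros (i & [] & _)|easy]).
    apply measurable_empty.
  - rewrite (set_ext _ (fun x => A j x \/ exists i, In i l /\ A i x)).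
    + apply measurable_union; [apply H|apply IH; intros; apply H]; simpl; auto.
    + intro x; split.
      * intros (i & [->|Hi] & Ai); [now left|right; now exists i].
      * intros [Aj|(i & Hi & Ai)]; [exists j|exists i]; simpl; auto.
Qed.

(** Adjacency between representatives below [p]; [circ_adj_shift] relates it to the periodic form
    [circ_nbr]. *)
Definition circ_adj (p q a b : nat) : Prop :=
  (a + q <= b <= a + (p - q))%nat \/ (b + q <= a <= b + (p - q))%nat.

Lemma circ_adj_sym (p q a b : nat) : circ_adj p q a b -> circ_adj p q b a.
Proof. unfold circ_adj; tauto. Qed.

Lemma circ_adj_shift (p q v d : nat) :
  (v < p)%nat -> (q <= d <= p - q)%nat -> (q <= p)%nat ->
  circ_adj p q v ((v + d) mod p).
Proof.
  intros vp dq qp; unfold circ_adj.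
  destruct (Nat.lt_ge_cases (v + d) p) as [h|h].
  - rewrite Nat.mod_small; lia.
  - replace (v + d)%nat with (v + d - p + 1 * p)%nat by lia.
    rewrite Nat.Div0.mod_add, Nat.mod_small; lia.
Qed.

Definition circ_nbr_colors (p q : nat) (f : nat -> R -> Prop) (v : nat) (x : R) : Prop :=
  circ_nbr p q (fun n => f (n mod p)%nat x) v.

Lemma unit_subset_mu (m : R) (S : R -> Prop) : unit_subset m S -> mu S = 1.
Proof. intros (_ & _ & H); now apply mu_eq. Qed.

Lemma circ_nbr_colors_bounded (p q : nat) (m : R) (f : nat -> R -> Prop) (v : nat) :
  (0 < p)%nat -> (forall v, (v < p)%nat -> unit_subset m (f v)) ->
  forall x, circ_nbr_colors p q f v x -> 0 <= x < m.
Proof.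
  intros p0 unit x (d & _ & Hd).
  apply (unit ((v + d) mod p)%nat); [apply Nat.mod_upper_bound; lia|exact Hd].
Qed.

Lemma circ_nbr_colors_measurable (p q : nat) (m : R) (f : nat -> R -> Prop) (v : nat) :
  (0 < p)%nat -> (forall v, (v < p)%nat -> unit_subset m (f v)) ->
  lebesgue_measurable (circ_nbr_colors p q f v).
Proof.
  intros p0 unit.
  rewrite (set_ext (circ_nbr_colors p q f v)
    (fun x => exists d, In d (seq q (S (p - q) - q)) /\ f ((v + d) mod p)%nat x)).
  - apply measurable_finite_union; intros d _.
    apply (unit ((v + d) mod p)%nat), Nat.mod_upper_bound; lia.
  - intro x; split; intros (d & Hd & Hf); exists d; split; auto.
    + apply in_seq; lia.
    + apply in_seq in Hd; lia.
Qed.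

(** The vertices whose sets contain a given color are independent, so [circ_independent_bounds]
    applies color by color. Integration over [0, m) gives the first bound directly and the second on
    average over the vertices. *)
Lemma circ_coloring_bounds (p q : nat) (m : R) (f : nat -> R -> Prop) :
  (0 < q)%nat -> (2 * q <= p)%nat -> 0 < m ->
  (forall v, (v < p)%nat -> unit_subset m (f v)) ->
  (forall a b, (a < p)%nat -> (b < p)%nat -> circ_adj p q a b -> forall x, ~ (f a x /\ f b x)) ->
  INR p <= INR q * m /\
  exists v, (v < p)%nat /\ INR p - INR q <= INR q * mu (circ_nbr_colors p q f v).
Proof.
  intros q0 pq m0 unit disj.
  assert (p0 : (0 < p)%nat) by lia.
  set (X := fun x => 0 <= x < m).
  assert (bX : bounded_set X) by (apply (bounded_set_within _ 0 m); unfold X; intros; lra).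
  assert (mX : mu X = m) by (unfold X; rewrite mu_interval; lra).
  assert (mf : forall v, In v (seq 0 p) -> mu (fun x => X x /\ f v x) = 1).
  { intros v Hv; apply in_seq in Hv. rewrite <- (unit_subset_mu m (f v)) by (apply unit; lia).
    f_equal; apply set_ext; intro x; split; [tauto|]. intro Hx; split; [|exact Hx].
    apply (unit v); [lia|exact Hx]. }
  assert (mU : forall v, mu (fun x => X x /\ circ_nbr_colors p q f v x) =
                mu (circ_nbr_colors p q f v)).
  { intro v; f_equal; apply set_ext; intro x; split; [tauto|]. intro Hx; split; [|exact Hx].
    now apply (circ_nbr_colors_bounded p q m f v). }
  assert (loc : forall x,
    lsum (seq 0 p) (fun v => indic (f v x)) <= INR q /\
    (INR p - INR q) * lsum (seq 0 p) (fun v => indic (f v x)) <=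
    INR q * lsum (seq 0 p) (fun v => indic (circ_nbr_colors p q f v x))).
  { intro x. set (P := fun n => f (n mod p)%nat x).
    destruct (circ_independent_bounds p q P) as [H1 H2]; [exact q0|exact pq| | |].
    - intro n; unfold P. replace (n + p)%nat with (n + 1 * p)%nat by lia.
      now rewrite Nat.Div0.mod_add.
    - intros n Pn (d & Hd & Pd); unfold P in Pn, Pd.
      assert (np : (n mod p < p)%nat) by (apply Nat.mod_upper_bound; lia).
      apply (disj (n mod p)%nat ((n + d) mod p)%nat) with x; [exact np| | |now split].
      + apply Nat.mod_upper_bound; lia.
      + rewrite <- Nat.Div0.add_mod_idemp_l. apply circ_adj_shift; lia.
    - replace (lsum (seq 0 p) (fun v => indic (f v x))) with (circ_count p P).
      + split; assumption.
      + apply lsum_ext; intros v Hv; apply in_seq in Hv; unfold P.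
        now rewrite Nat.mod_small by lia. }
  split.
  - rewrite <- mX, <- (Rmult_1_r (INR p)).
    replace (INR p) with (INR (length (seq 0 p))) by now rewrite length_seq.
    rewrite <- lsum_const.
    rewrite (lsum_ext _ _ (fun v => 1 * mu (fun x => X x /\ f v x)))
      by (intros v Hv; rewrite mf by exact Hv; lra).
    apply lsum_mu_le; [exact bX| |].
    + intros v Hv; apply in_seq in Hv; apply (unit v); lia.
    + intros x _; rewrite lsum_scal, Rmult_1_l; apply loc.
  - destruct (lsum_pigeonhole (seq 0 p)
      (fun v => INR q * mu (circ_nbr_colors p q f v)) (INR p - INR q)) as (v & Hv & Hm).
    + destruct p; [lia|easy].
    (* Both sides of the pointwise inequality are sums of indicators. Signed coefficients over a
       disjoint union of indices bring them into one sum that is at most 0. *)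
    + set (c := fun s : nat + nat => match s with inl _ => INR p - INR q | inr _ => - INR q end).
      set (A := fun s : nat + nat =>
                  match s with inl v => f v | inr v => circ_nbr_colors p q f v end).
      set (l := map inl (seq 0 p) ++ map inr (seq 0 p)).
      assert (mA : forall s, In s l -> lebesgue_measurable (A s)).
      { intros [v|v] Hs; unfold l in Hs; apply in_app_or in Hs; rewrite !in_map_iff in Hs.
        - destruct Hs as [(w & E & Hw)|(w & E & _)]; [|discriminate].
          injection E as ->; apply in_seq in Hw; apply (unit v); lia.
        - now apply circ_nbr_colors_measurable with m. }
      assert (le0 : forall x, X x -> lsum l (fun s => c s * indic (A s x)) <= 0).
      { intros x _; unfold l, c, A; rewrite lsum_app, !lsum_map; simpl; rewrite !lsum_scal.
        specialize (loc x); lra. }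
      generalize (lsum_mu_le l c A X 0 bX mA le0).
      unfold l, c, A; rewrite lsum_app, !lsum_map; simpl.
      rewrite !lsum_scal, (lsum_ext _ _ _ mf), (lsum_ext _ _ _ (fun v _ => mU v)), lsum_const.
      lra.
    + exists v; apply in_seq in Hv; split; [lia|exact Hm].
Qed.

(** Each [g i] has measure one and avoids U and the arc C, so |U| + 1 - |U and C| <= m - 1: every
    arc meets U in measure at least |U| + 2 - m. Summed over the arcs, this is bounded by
    integrating [circle_arc_overlap] over U. *)
Lemma circle_arc_averaging (m : R) (n : nat) (U : R -> Prop) (g : nat -> R -> Prop) :
  1 <= m -> (0 < n)%nat -> (forall x, U x -> 0 <= x < m) ->
  (forall i, (i < n)%nat -> unit_subset m (g i)) ->
  (forall i x, (i < n)%nat -> g i x -> ~ circle_arc m (INR i * (m / INR n)) x /\ ~ U x) ->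
  INR n * (mu U + 2 - m) <= (INR n / m + 2) * mu U.
Proof.
  intros m1 n0 inU unit disj.
  assert (N0 : 0 < INR n) by now apply lt_0_INR.
  set (C := fun i => circle_arc m (INR i * (m / INR n))).
  assert (unitC : forall i, In i (seq 0 n) -> unit_subset m (C i)).
  { intros i Hi; apply in_seq in Hi. apply circle_arc_unit; [exact m1|].
    assert (i0 : 0 <= INR i) by apply pos_INR.
    assert (iN : INR i < INR n) by (apply lt_INR; lia).
    split; [apply Rmult_le_pos; [exact i0|apply Rlt_le, Rdiv_lt_0_compat; lra]|].
    replace (INR i * (m / INR n)) with (m * (INR i / INR n)) by (field; lra).
    rewrite <- (Rmult_1_r m) at 2; apply Rmult_lt_compat_l; [lra|].
    apply Rmult_lt_reg_r with (INR n); [exact N0|].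
    unfold Rdiv; rewrite Rmult_assoc, Rinv_l by lra; lra. }
  assert (bU : bounded_set U)
    by (apply (bounded_set_within _ 0 m); intros x Ux; specialize (inU x Ux); lra).
  assert (each : forall i, In i (seq 0 n) -> mu U + 2 - m <= 1 * mu (fun x => U x /\ C i x)).
  { intros i Hi; specialize (unitC i Hi); apply in_seq in Hi.
    assert (ug := unit i ltac:(lia)).
    set (X := fun x => 0 <= x < m).
    assert (bX : bounded_set X) by (apply (bounded_set_within _ 0 m); unfold X; intros; lra).
    assert (bX' : bounded_set (fun x => X x /\ ~ g i x))
      by (apply bounded_set_sub with X; cbv beta; tauto).
    assert (mX : mu X = m) by (unfold X; rewrite mu_interval; lra).
    rewrite (mu_split X (g i) bX), (mu_split (fun x => X x /\ ~ g i x) (C i) bX') in mX;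
      [|apply unitC|apply ug].
    rewrite (set_ext (fun x => X x /\ g i x) (g i)) in mX
      by (intro x; generalize (proj1 ug x); unfold X; tauto).
    rewrite (set_ext (fun x => (X x /\ ~ g i x) /\ C i x) (C i)) in mX
      by (intro x; generalize (proj1 unitC x) (disj i x); unfold X, C; intuition lia).
    rewrite (unit_subset_mu _ _ ug), (unit_subset_mu _ _ unitC) in mX.
    assert (mu (fun x => U x /\ ~ C i x) <= mu (fun x => (X x /\ ~ g i x) /\ ~ C i x)).
    { apply mu_mono; [apply bounded_set_sub with X; cbv beta; tauto|].
      intros x [Ux NC]; split; [split|exact NC]; [now apply inU|].
      intro gx; now apply (disj i x). }
    rewrite (mu_split U (C i) bU) by apply unitC. lra. }
  rewrite <- (length_seq n 0) at 1; rewrite <- lsum_const.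
  eapply Rle_trans; [apply lsum_le, each|].
  apply lsum_mu_le; [exact bU|intros i Hi; apply (unitC i Hi)|].
  intros x Ux; rewrite lsum_scal, Rmult_1_l.
  apply circle_arc_overlap; [lra|exact n0|now apply inU].
Qed.

(** * The graph *)

(* Vertex [x] lies over [x / (2 n + 1)] in the circular clique and has kind
   [t = x mod (2 n + 1)]: a vertex of the clique itself if [t = 0]; if [1 <= t <= n], a
   vertex joined to the clique neighbours of the base; if [t > n], a pendant vertex
   attached to the vertex of kind [t - n] over the same base. *)
Definition gsize (n : nat) : nat := S (2 * n).

Definition base (n x : nat) : nat := (x / gsize n)%nat.

Definition kind (n x : nat) : nat := (x mod gsize n)%nat.

Definition vert (n v t : nat) : nat := (t + v * gsize n)%nat.

Lemma base_vert (n v t : nat) : (t < gsize n)%nat -> base n (vert n v t) = v.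
Proof.
  intro H; unfold base, vert. rewrite Nat.div_add by (unfold gsize; lia).
  now rewrite Nat.div_small.
Qed.

Lemma kind_vert (n v t : nat) : (t < gsize n)%nat -> kind n (vert n v t) = t.
Proof.
  intro H; unfold kind, vert. rewrite Nat.Div0.mod_add. now apply Nat.mod_small.
Qed.

Lemma vert_lt (p n v t : nat) :
  (v < p)%nat -> (t < gsize n)%nat -> (vert n v t < p * gsize n)%nat.
Proof. unfold vert; nia. Qed.

Lemma vert_base_kind (n x : nat) : vert n (base n x) (kind n x) = x.
Proof.
  unfold vert, base, kind. rewrite Nat.add_comm, Nat.mul_comm; symmetry; apply Nat.div_mod_eq.
Qed.

Lemma base_lt (p n x : nat) : (x < p * gsize n)%nat -> (base n x < p)%nat.
Proof. intro H; apply Nat.Div0.div_lt_upper_bound; lia. Qed.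

(** An orientation of each edge. The first clause gives the clique edges when [kind n x = 0] and
    otherwise joins a copy to the clique neighbours of its base. *)
Definition gadget_link (p q n x y : nat) : Prop :=
  (circ_adj p q (base n x) (base n y) /\ (kind n x <= n)%nat /\ kind n y = 0%nat) \/
  (base n x = base n y /\ (1 <= kind n x <= n)%nat /\ kind n y = (kind n x + n)%nat).

Definition gadget_adj (p q n x y : nat) : Prop :=
  ((x < p * gsize n)%nat /\ (y < p * gsize n)%nat) /\
  (gadget_link p q n x y \/ gadget_link p q n y x).

Lemma gadget_adj_sym (p q n x y : nat) : gadget_adj p q n x y -> gadget_adj p q n y x.
Proof. unfold gadget_adj; tauto. Qed.

Lemma gadget_adj_irrefl (p q n : nat) : (0 < q)%nat -> forall x, ~ gadget_adj p q n x x.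
Proof. unfold gadget_adj, gadget_link, circ_adj; lia. Qed.

Lemma gadget_adj_vert (p q n x y : nat) :
  gadget_adj p q n x y -> (x < p * gsize n)%nat /\ (y < p * gsize n)%nat.
Proof. unfold gadget_adj; tauto. Qed.

Definition gadget_graph (p q n : nat) (q0 : (0 < q)%nat) : graph :=
  {| gn := p * gsize n;
     gadj := gadget_adj p q n;
     gadj_sym := gadget_adj_sym p q n;
     gadj_irrefl := gadget_adj_irrefl p q n q0;
     gadj_vert := gadget_adj_vert p q n |}.

Definition pendant (p n x : nat) : Prop := (x < p * gsize n)%nat /\ (n < kind n x)%nat.

(** The only neighbour of a pendant vertex is its copy of kind between 1 and [n]. Distinct pendant
    vertices have distinct copies, and no two copies are adjacent. *)
Lemma pendant_distance (p q n : nat) (q0 : (0 < q)%nat) :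
  pairwise_dist_ge4 (gadget_graph p q n q0) (pendant p n).
Proof.
  assert (nbr : forall x y, pendant p n x -> gadget_adj p q n x y ->
            base n y = base n x /\ (1 <= kind n y <= n)%nat /\ kind n x = (kind n y + n)%nat).
  { unfold pendant, gadget_adj, gadget_link; intros x y; lia. }
  assert (eq : forall x y, base n x = base n y -> kind n x = kind n y -> x = y).
  { intros x y Hb Hk. now rewrite <- (vert_base_kind n x), <- (vert_base_kind n y), Hb, Hk. }
  intros u v Wu Wv uv (k & k3 & Hw).
  destruct k as [|[|[|[|k]]]]; simpl in Hw.
  - now apply uv.
  - destruct Hw as (a & Ha & ->). apply (nbr u v Wu) in Ha; destruct Wv; lia.
  - destruct Hw as (a & Ha & b & Hb & ->). apply uv, eq;
      generalize (nbr u a Wu Ha) (nbr v a Wv (gadget_adj_sym _ _ _ _ _ Hb)); lia.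
  - destruct Hw as (a & Ha & b & Hb & c & Hc & ->).
    generalize (nbr u a Wu Ha) (nbr v b Wv (gadget_adj_sym _ _ _ _ _ Hc)).
    destruct Hb as [_ Hb]; unfold gadget_link in Hb; lia.
  - lia.
Qed.

(** * The fractional chromatic number of the graph *)

Lemma unit_le (a b r : R) : 0 < r -> a + r <= b -> a / r + 1 <= b / r.
Proof.
  intros r0 H. apply Rmult_le_reg_r with r; [exact r0|].
  rewrite Rmult_plus_distr_r. unfold Rdiv; rewrite !Rmult_assoc, Rinv_l by lra. lra.
Qed.

(** On the circle of length p/q, the starting points of adjacent vertices are at least one apart in
    both directions. *)
Lemma circ_arcs_disjoint (p q a b : nat) (x : R) :
  (0 < q)%nat -> (a < p)%nat -> (b < p)%nat -> circ_adj p q a b ->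
  ~ (circle_arc (INR p / INR q) (INR a / INR q) x /\
     circle_arc (INR p / INR q) (INR b / INR q) x).
Proof.
  intro q0; revert a b.
  assert (Q0 : 0 < INR q) by now apply lt_0_INR.
  assert (H : forall a b, (b < p)%nat -> (a + q <= b <= a + (p - q))%nat ->
    ~ (circle_arc (INR p / INR q) (INR a / INR q) x /\
       circle_arc (INR p / INR q) (INR b / INR q) x)).
  { intros a b bp [h1 h2].
    assert (A : INR a / INR q + 1 <= INR b / INR q)
      by (apply unit_le; [exact Q0|rewrite <- plus_INR; now apply le_INR]).
    assert (B : INR b / INR q + 1 <= INR (a + p) / INR q)
      by (apply unit_le; [exact Q0|rewrite <- plus_INR; apply le_INR; lia]).
    assert (C : INR b / INR q < INR p / INR q)
      by (apply Rmult_lt_compat_r; [now apply Rinv_0_lt_compat|now apply lt_INR]).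
    rewrite plus_INR, Rdiv_plus_distr in B. unfold circle_arc; lra. }
  intros a b ap bp [h|h]; [now apply H|]. intros [h1 h2]; now apply (H b a ap h).
Qed.

(** A homomorphism onto the clique, along which its coloring is pulled back. A pendant vertex goes
    to [base + q], a neighbour of the image of its copy. *)
Definition retract (p q n x : nat) : nat :=
  if Nat.leb (kind n x) n then base n x else ((base n x + q) mod p)%nat.

Lemma retract_adj (p q n x y : nat) :
  (0 < q)%nat -> (2 * q <= p)%nat -> gadget_adj p q n x y ->
  circ_adj p q (retract p q n x) (retract p q n y).
Proof.
  intros q0 pq.
  assert (H : forall x y, (x < p * gsize n)%nat -> gadget_link p q n x y ->
            circ_adj p q (retract p q n x) (retract p q n y)).
  { clear x y; intros x y xp [(A & Hx & Hy)|(B & Hx & Hy)]; unfold retract.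
    - destruct (Nat.leb_spec (kind n x) n), (Nat.leb_spec (kind n y) n); try lia; exact A.
    - destruct (Nat.leb_spec (kind n x) n), (Nat.leb_spec (kind n y) n); try lia; rewrite <- B.
      apply circ_adj_shift; [now apply base_lt|lia|lia]. }
  intros [[xp yp] [A|A]]; [now apply H|now apply circ_adj_sym, H].
Qed.

Lemma gadget_graph_colorable (p q n : nat) (q0 : (0 < q)%nat) :
  (2 * q <= p)%nat -> frac_colorable (gadget_graph p q n q0) (INR p / INR q).
Proof.
  intro pq.
  assert (Q0 : 0 < INR q) by now apply lt_0_INR.
  assert (P0 : INR q <= INR p) by (apply le_INR; lia).
  assert (r : forall x, (x < p * gsize n)%nat -> (retract p q n x < p)%nat).
  { intros x xp; unfold retract; destruct Nat.leb; [now apply base_lt|].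
    apply Nat.mod_upper_bound; lia. }
  exists (fun x => circle_arc (INR p / INR q) (INR (retract p q n x) / INR q)).
  split; [|split].
  - apply Rdiv_lt_0_compat; lra.
  - intros x xp; apply circle_arc_unit.
    + generalize (unit_le 0 (INR p) (INR q) Q0); unfold Rdiv at 1; lra.
    + specialize (r x xp).
      split; [apply Rmult_le_pos; [apply pos_INR|apply Rlt_le, Rinv_0_lt_compat, Q0]|].
      apply Rmult_lt_compat_r; [apply Rinv_0_lt_compat, Q0|now apply lt_INR].
  - intros x y xy z; apply circ_arcs_disjoint; [exact q0|apply r, xy|apply r, xy|].
    now apply (retract_adj p q n).
Qed.

Lemma clique_coloring (p q n : nat) (q0 : (0 < q)%nat) (m : R) (f : nat -> R -> Prop) :
  frac_coloring (gadget_graph p q n q0) m f ->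
  (forall v, (v < p)%nat -> unit_subset m (f (vert n v 0))) /\
  (forall a b, (a < p)%nat -> (b < p)%nat -> circ_adj p q a b ->
     forall x, ~ (f (vert n a 0) x /\ f (vert n b 0) x)).
Proof.
  intros (_ & unit & disj); split.
  - intros v vp; apply unit, vert_lt; [exact vp|unfold gsize; lia].
  - intros a b ap bp ab; apply disj; simpl. split; [split|left; left].
    + apply vert_lt; [exact ap|unfold gsize; lia].
    + apply vert_lt; [exact bp|unfold gsize; lia].
    + rewrite !base_vert, !kind_vert by (unfold gsize; lia); split; [exact ab|lia].
Qed.

Lemma gadget_graph_chromatic (p q n : nat) (q0 : (0 < q)%nat) :
  (2 * q <= p)%nat -> frac_chromatic_number (gadget_graph p q n q0) (INR p / INR q).
Proof.
  intro pq; split.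
  - intros m [f Hf].
    assert (Q0 : 0 < INR q) by now apply lt_0_INR.
    destruct (clique_coloring p q n q0 m f Hf) as [unit disj].
    destruct (circ_coloring_bounds p q m _ q0 pq (proj1 Hf) unit disj) as [H _].
    apply Rmult_le_reg_r with (INR q); [exact Q0|].
    unfold Rdiv; rewrite Rmult_assoc, Rinv_l by lra; lra.
  - intros k' H; apply H, gadget_graph_colorable, pq.
Qed.

(** * The precoloring by arcs and its non-extendability *)

Definition arc_precoloring (m : R) (n x : nat) : R -> Prop :=
  circle_arc m (INR (kind n x - S n) * (m / INR n)).

Lemma arc_precoloring_unit (m : R) (n x : nat) :
  1 <= m -> (n < kind n x)%nat -> unit_subset m (arc_precoloring m n x).
Proof.
  intros m1 kx; apply circle_arc_unit; [exact m1|].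
  assert (kn : (kind n x < gsize n)%nat)
    by (apply Nat.mod_upper_bound; unfold gsize; lia).
  unfold gsize in kn.
  assert (N0 : 0 < INR n) by (apply lt_0_INR; lia).
  split; [apply Rmult_le_pos; [apply pos_INR|apply Rlt_le, Rdiv_lt_0_compat; lra]|].
  apply Rlt_le_trans with (INR n * (m / INR n)); [|apply Req_le; field; lra].
  apply Rmult_lt_compat_r; [apply Rdiv_lt_0_compat; lra|apply lt_INR; lia].
Qed.

(** Here [r] is the measure of the colors on the clique neighbours of the vertex [v] found by
    [circ_coloring_bounds]. The [n] copies of [v] avoid these colors, and each avoids its own
    arc. *)
Lemma extension_bound (p q n : nat) (q0 : (0 < q)%nat) (m : R) :
  (2 * q <= p)%nat -> (0 < n)%nat -> 1 <= m ->
  precoloring_extends (gadget_graph p q n q0) m (pendant p n) (arc_precoloring m n) ->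
  exists r, INR p / INR q - 1 <= r /\ INR n * (r + 2 - m) <= (INR n / m + 2) * r.
Proof.
  intros pq n0 m1 (f & Hf & ext).
  assert (Q0 : 0 < INR q) by now apply lt_0_INR.
  destruct (clique_coloring p q n q0 m f Hf) as [unitc disjc].
  destruct (circ_coloring_bounds p q m _ q0 pq (proj1 Hf) unitc disjc) as (_ & v & vp & Hv).
  set (g := fun v => f (vert n v 0)) in *.
  exists (mu (circ_nbr_colors p q g v)); split.
  { apply Rmult_le_reg_l with (INR q); [exact Q0|].
    replace (INR q * (INR p / INR q - 1)) with (INR p - INR q) by (field; lra). exact Hv. }
  destruct Hf as (_ & unit & disj).
  apply circle_arc_averaging with (fun i => f (vert n v (S i))); [exact m1|exact n0| | |].
  - apply circ_nbr_colors_bounded; [lia|exact unitc].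
  - intros i Hi; apply unit, vert_lt; [exact vp|unfold gsize; lia].
  - intros i x Hi fx; split; [intro Cx|intros (d & Hd & gx)].
    + assert (k1 : (S i < gsize n)%nat) by (unfold gsize; lia).
      assert (k2 : (S i + n < gsize n)%nat) by (unfold gsize; lia).
      (* The pendant vertex at copy [S i] has kind [S i + n], hence carries the arc of index
         [S i + n - S n = i]. *)
      apply (disj (vert n v (S i)) (vert n v (S i + n))) with x.
      * split; [split; now apply vert_lt|left; right].
        rewrite !base_vert, !kind_vert by assumption; lia.
      * split; [exact fx|]. apply ext.
        -- split; [now apply vert_lt|]. rewrite kind_vert by assumption; lia.
        -- unfold arc_precoloring. rewrite kind_vert by assumption.
           now replace (S i + n - S n)%nat with i by lia.
    + assert (k0 : (0 < gsize n)%nat) by (unfold gsize; lia).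
      assert (k1 : (S i < gsize n)%nat) by (unfold gsize; lia).
      assert (bp : ((v + d) mod p < p)%nat) by (apply Nat.mod_upper_bound; lia).
      apply (disj (vert n v (S i)) (vert n ((v + d) mod p) 0)) with x; [|now split].
      split; [split; now apply vert_lt|left; left].
      rewrite !base_vert, !kind_vert by assumption.
      split; [apply circ_adj_shift; lia|lia].
Qed.

Lemma rational_ratio (k : R) :
  (exists r : Q, k = Q2R r) -> 2 <= k ->
  exists p q, (0 < q)%nat /\ (2 * q <= p)%nat /\ k = INR p / INR q.
Proof.
  intros [[a b] ->] k2; unfold Q2R in k2 |- *; cbn [Qnum Qden] in *.
  assert (b0 : 0 < IZR (Zpos b)) by (apply IZR_lt; reflexivity).
  assert (ab : 2 * IZR (Zpos b) <= IZR a).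
  { apply Rmult_le_reg_r with (/ IZR (Zpos b)); [now apply Rinv_0_lt_compat|].
    rewrite Rmult_assoc, Rinv_r by lra; lra. }
  rewrite <- mult_IZR in ab; apply le_IZR in ab.
  exists (Z.to_nat a), (Pos.to_nat b); split; [lia|split; [lia|]].
  rewrite !INR_IZR_INZ, Z2Nat.id, positive_nat_Z by lia; reflexivity.
Qed.

Theorem mainTheorem9 (k eps : R) :
  (exists q : Q, k = Q2R q) -> 2 <= k < 3 -> 0 < eps ->
  eps < (1 + eps) / (k + eps) ->
  exists (G : graph) (W : nat -> Prop) (p : nat -> R -> Prop),
    frac_chromatic_number G k /\
    (forall w, W w -> vertex G w) /\
    pairwise_dist_ge4 G W /\
    frac_precoloring G (k + eps) W p /\
    ~ precoloring_extends G (k + eps) W p.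
Proof.
  intros kQ [k2 _] e0 Heps.
  destruct (rational_ratio k kQ k2) as (p & q & q0 & pq & kE).
  set (m := k + eps) in *.
  assert (m2 : 2 < m) by (unfold m; lra).
  assert (Hm : eps * m < 1 + eps).
  { apply Rmult_lt_compat_r with (r := m) in Heps; [|lra].
    unfold Rdiv in Heps; rewrite Rmult_assoc, Rinv_l in Heps; lra. }
  (* [delta > 0] says that a color set of measure [k - 1], together with a unit set in
     general position, leaves less than a unit of the [m] colors. *)
  set (delta := (k - 1) * (1 - / m) - (m - 2)).
  assert (d0 : 0 < delta).
  { apply Rmult_lt_reg_r with m; [lra|]. rewrite Rmult_0_l.
    replace (delta * m) with ((k - 1) * (m - 1) - (m - 2) * m) by (unfold delta; field; lra).
    (* After this substitution the expression equals [1 + eps - eps * m], positive by [Hm]. *)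
    replace k with (m - eps) by (unfold m; lra). nra. }
  (* With this many arcs, the rounding error 2 in [circle_arc_overlap] is outweighed by [delta]. *)
  destruct (INR_unbounded (2 * (k - 1) / delta)) as [n Hn].
  assert (Hn' : 2 * (k - 1) < delta * INR n).
  { apply Rmult_lt_compat_r with (r := delta) in Hn; [|exact d0].
    replace (2 * (k - 1) / delta * delta) with (2 * (k - 1)) in Hn by (field; lra). lra. }
  assert (N0 : 0 < INR n) by nra.
  exists (gadget_graph p q n q0), (pendant p n), (arc_precoloring m n).
  split; [|split; [|split; [|split]]].
  - rewrite kE; now apply gadget_graph_chromatic.
  - now intros w [Hw _].
  - apply pendant_distance.
  - split; [lra|]. intros w [_ Hw]; apply arc_precoloring_unit; [lra|exact Hw].
  - intro ext.
    destruct (extension_bound p q n q0 m pq) as (r & Hr & Hb); [now apply INR_lt|lra|exact ext|].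
    rewrite <- kE in Hr.
    (* The bound [Hb] reads [c * r <= INR n * (m - 2)]. It fails at [r = k - 1], where the
       difference is [delta * INR n - 2 * (k - 1)], and so for all larger [r] because [c] is
       positive. *)
    set (c := INR n * (1 - / m) - 2).
    assert (Hc : c * r <= INR n * (m - 2)) by (unfold c; unfold Rdiv in Hb; nra).
    assert (Hk : INR n * (m - 2) < c * (k - 1)) by (unfold c, delta in *; nra).
    assert (0 < c).
    { apply Rmult_lt_reg_r with (k - 1); [lra|]. rewrite Rmult_0_l.
      apply Rle_lt_trans with (2 := Hk); apply Rmult_le_pos; lra. }
    nra.
Qed.
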